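(* There exists a function $\mathrm{A}:2^{<\omega}\to\mathbb{N}$ satisfying all of the following: (1) $\mathrm{A}$ is upper semi-computable, i.e. the predicate ''$\mathrm{A}(x)\le k$'' is computably enumerable uniformly in $x$ and $k$; (2) there is a constant $c$ such that $\mathrm{A}(x)\le |x|+c$ for all $x\in 2^{<\omega}$; (3) there is a constant $d$ such that $|\{x\in 2^{<\omega} : \mathrm{A}(x)\le n\}|\le d\cdot 2^{n}$ for all $n\in\mathbb{N}$; (4) for every total computable function $f:2^{<\omega}\to 2^{<\omega}$ there exists a constant $c_f$ such that $\mathrm{A}(f(x))\le \mathrm{A}(x)+c_f$ for every $x\in 2^{<\omega}$; (5) $|\mathrm{A}(x)-\mathrm{C}(x)|$ is unbounded as $x$ ranges over $2^{<\omega}$.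
   Context: $2^{<\omega}$ denotes the set of finite binary strings, identified with natural numbers in the standard way; $|x|$ is the length of $x$. For a Turing machine $T$, $\mathrm{C}_T(x)=\min\{|y| : T(y)=x\}$. A machine $\mathbb{U}$ is optimal if for every machine $T$ there is a constant $c_T$ with $\mathrm{C}_{\mathbb{U}}(x)\le \mathrm{C}_T(x)+c_T$ for all $x$; fix such an optimal $\mathbb{U}$ and let $\mathrm{C}=\mathrm{C}_{\mathbb{U}}$ be plain Kolmogorov complexity. *)

(* Defs.v *)
From mathcomp Require Import all_boot.
Set Implicit Arguments.
Unset Strict Implicit.
Unset Printing Implicit Defensive.

(* Syntax of partial recursive functions. Arguments are passed as a list of
   naturals; missing arguments default to 0. *)
Inductive prf : Type :=
| Zero : prf
| Succ : prf
| Proj : nat -> prf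
| Comp : prf -> list prf -> prf
| PrimRec : prf -> prf -> prf
| Mu : prf -> prf.

Inductive eval : prf -> seq nat -> nat -> Prop :=
| ev_zero xs : eval Zero xs 0
| ev_succ xs : eval Succ xs (head 0 xs).+1
| ev_proj i xs : eval (Proj i) xs (nth 0 xs i)
| ev_comp f gs xs ys y :
    evals gs xs ys -> eval f ys y -> eval (Comp f gs) xs y
| ev_rec0 f g xs y : eval f xs y -> eval (PrimRec f g) (0 :: xs) y
| ev_recS f g n xs r y :
    eval (PrimRec f g) (n :: xs) r -> eval g (n :: r :: xs) y ->
    eval (PrimRec f g) (n.+1 :: xs) y
| ev_mu f xs n :
    eval f (n :: xs) 0 ->
    (forall m, m < n -> exists v, eval f (m :: xs) v.+1) ->
    eval (Mu f) xs n
with evals : seq prf -> seq nat -> seq nat -> Prop :=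
| evs_nil xs : evals [::] xs [::]
| evs_cons g gs xs y ys :
    eval g xs y -> evals gs xs ys -> evals (g :: gs) xs (y :: ys).

(* Finite binary strings are identified with naturals in the standard way:
   x <-> the binary expansion of x+1 with its leading 1 removed.
   Hence |x| = floor(log2 (x+1)). *)
Definition len (x : nat) : nat := trunc_log 2 x.+1.

(* U is optimal: for every machine T there is c_T with C_U(x) <= C_T(x) + c_T,
   i.e. every T-description y of x yields a U-description of length
   <= |y| + c_T. *)
Definition optimal (U : prf) : Prop :=
  forall T : prf, exists c : nat, forall x y : nat,
    eval T [:: y] x -> exists y', eval U [:: y'] x /\ len y' <= len y + c.

Definition KC (T : prf) (x n : nat) : Prop :=
  (exists y, eval T [:: y] x /\ len y = n) /\
  (forall y, eval T [:: y] x -> n <= len y).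

Definition upper_semicomputable (A : nat -> nat) : Prop :=
  exists p : prf, forall x k : nat, A x <= k <-> exists v, eval p [:: x; k] v.

Definition total_computable (f : nat -> nat) : Prop :=
  exists p : prf, forall x : nat, eval p [:: x] (f x).

(* Main.v *)
(* Let [W] be a universal machine with a step count. A program [y] for [x] counts for [A x] only
   if it halts within a clock built from some [z <= y] by repeatedly passing from [u] to [tau_e u],
   the time machine [e] needs to halt on all inputs up to [u]; each such passage costs
   [4 (e + 1)], added to the length of [y]. A total computable function distorts running times by
   a total computable function, which is dominated by one more passage, so [A] grows by a
   constant. A partial [e] has a [tau_e] with finite domain.

   For the gap, fix [k] and a long [y], last to halt among the programs of at most its length.
   From [y], [k] and the index [e < k] that is slowest on [0..y+1] among those halting there, a
   machine finds out which indices below [k] are total and bounds every clock of cost below [4k],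
   and every halting time of programs no longer than [y], by a number [x]. Values are smaller
   than halting times, so [A x] is at least [len y + 4k], while [C x <= len y + 2k + O(1)]. *)
Require Import Defs.
From Stdlib Require Import Classical ClassicalEpsilon.
From mathcomp Require Import all_boot zify.
Set Implicit Arguments.
Unset Strict Implicit.
Unset Printing Implicit Defensive.

(** * Computable functions and their closure under primitive recursive operations *)

(* The environment [v] maps [i] to the [i]-th argument. *)
Definition pr k (F : (nat -> nat) -> nat) :=
  exists p, forall xs, size xs = k -> eval p xs (F (nth 0 xs)).

Lemma pr_ext k F G : (forall v, F v = G v) -> pr k F -> pr k G.
Proof. by move=> FG [p Hp]; exists p => xs /Hp; rewrite FG. Qed.

Lemma pr_var k i : pr k (fun v => v i).
Proof. by exists (Proj i) => xs _; apply: ev_proj. Qed.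

Lemma pr_S k F : pr k F -> pr k (fun v => (F v).+1).
Proof.
case=> p Hp; exists (Comp Succ [:: p]) => xs /Hp E.
by apply: (ev_comp (ys := [:: F (nth 0 xs)])); [do 2?constructor | exact: ev_succ].
Qed.

Lemma pr_const k c : pr k (fun=> c).
Proof.
elim: c => [|c]; last exact: pr_S.
by exists Zero => xs _; apply: ev_zero.
Qed.

Lemma pr_app1 k (f : nat -> nat) F :
  pr 1 (fun v => f (v 0)) -> pr k F -> pr k (fun v => f (F v)).
Proof.
move=> [q Hq] [p Hp]; exists (Comp q [:: p]) => xs /Hp E.
apply: (ev_comp (ys := [:: F (nth 0 xs)])); first by do 2?constructor.
exact: (Hq [:: _]).
Qed.

Lemma pr_app2 k (f : nat -> nat -> nat) F G :
  pr 2 (fun v => f (v 0) (v 1)) -> pr k F -> pr k G ->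
  pr k (fun v => f (F v) (G v)).
Proof.
move=> [q Hq] [p Hp] [r Hr]; exists (Comp q [:: p; r]) => xs sz.
apply: (ev_comp (ys := [:: F (nth 0 xs); G (nth 0 xs)])).
  by do 3?constructor; auto.
exact: (Hq [:: _; _]).
Qed.

Lemma pr_app3 k (f : nat -> nat -> nat -> nat) F G H :
  pr 3 (fun v => f (v 0) (v 1) (v 2)) -> pr k F -> pr k G -> pr k H ->
  pr k (fun v => f (F v) (G v) (H v)).
Proof.
move=> [q Hq] [p Hp] [r Hr] [s Hs]; exists (Comp q [:: p; r; s]) => xs sz.
apply: (ev_comp (ys := [:: F (nth 0 xs); G (nth 0 xs); H (nth 0 xs)])).
  by do 4?constructor; auto.
exact: (Hq [:: _; _; _]).
Qed.

Lemma evals_proj js xs : evals (map Proj js) xs (map (nth 0 xs) js).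
Proof. by elim: js => [|j js IH] /=; constructor=> //; apply: ev_proj. Qed.

(** [PrimRec] recurses on the head of the list and its step sees counter and accumulator first, so
    the parameters are copied behind the value of [N] and later shifted by two. *)
Lemma pr_rec k N F G :
  pr k N -> pr k F -> pr k.+2 (fun v => G (v 0) (v 1) (fun i => v i.+2)) ->
  pr k (fun v => nat_rect (fun=> nat) (F v) (fun n r => G n r v) (N v)).
Proof.
move=> [n Hn] [f Hf] [g Hg].
exists (Comp (PrimRec f g) (n :: map Proj (iota 0 k))) => xs sz.
apply: (ev_comp (ys := N (nth 0 xs) :: xs)).
  constructor; first exact: Hn.
  have E : map (nth 0 xs) (iota 0 k) = xs by rewrite -sz; apply: mkseq_nth.
  by rewrite -{2}E; apply: evals_proj.
elim: (N _) => [|m IH] /=; first by constructor; apply: Hf.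
by apply: (ev_recS IH); apply: (Hg [:: _, _ & _]); rewrite /= sz.
Qed.

Lemma pr_pred k F : pr k F -> pr k (fun v => (F v).-1).
Proof.
move=> HF; apply: pr_ext (pr_rec (G := fun n _ _ => n) HF (pr_const _ 0) (pr_var _ 0)).
by move=> v /=; case: (F v).
Qed.

Lemma pr_add k F G : pr k F -> pr k G -> pr k (fun v => F v + G v).
Proof.
move=> HF HG; apply: pr_ext (pr_rec (G := fun _ r _ => r.+1) HF HG (pr_S (pr_var _ 1))).
by move=> v /=; elim: (F v) => //= n ->.
Qed.

Lemma pr_sub k F G : pr k F -> pr k G -> pr k (fun v => F v - G v).
Proof.
move=> HF HG; apply: pr_ext (pr_rec (G := fun _ r _ => r.-1) HG HF (pr_pred (pr_var _ 1))).
by move=> v /=; elim: (G v) => [|n /= ->]; rewrite ?subn0 ?subnS.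
Qed.

Lemma pr_mul k F G : pr k F -> pr k G -> pr k (fun v => F v * G v).
Proof.
apply: pr_app2.
apply: pr_ext (pr_rec (G := fun _ r v => v 1 + r) (pr_var _ 0) (pr_const _ 0) _).
  by move=> v /=; elim: (v 0) => //= n ->; rewrite mulSn.
exact: pr_add (pr_var _ 3) (pr_var _ 1).
Qed.

Lemma pr_exp2 k F : pr k F -> pr k (fun v => 2 ^ F v).
Proof.
move=> HF.
apply: pr_ext (pr_rec (G := fun _ r _ => r + r) HF (pr_const _ 1)
                 (pr_add (pr_var _ 1) (pr_var _ 1))).
by move=> v /=; elim: (F v) => //= n ->; rewrite expnS mul2n addnn.
Qed.

Lemma pr_if k B F G : pr k (fun v => nat_of_bool (B v)) -> pr k F -> pr k G ->
  pr k (fun v => if B v then F v else G v).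
Proof.
move=> HB HF HG.
apply: pr_ext (pr_add (pr_mul HB HF) (pr_mul (pr_sub (pr_const _ 1) HB) HG)) => v.
by case: (B v) => /=; lia.
Qed.

Lemma pr_leq k F G : pr k F -> pr k G -> pr k (fun v => nat_of_bool (F v <= G v)).
Proof.
move=> HF HG; apply: pr_ext (pr_sub (pr_const _ 1) (pr_sub HF HG)) => v.
by case: leqP; lia.
Qed.

Lemma pr_eq k F G : pr k F -> pr k G -> pr k (fun v => nat_of_bool (F v == G v)).
Proof.
move=> HF HG; apply: pr_ext (pr_mul (pr_leq HF HG) (pr_leq HG HF)) => v.
by rewrite eqn_leq; do 2 case: (_ <= _).
Qed.

Lemma pr_and k B C : pr k (fun v => nat_of_bool (B v)) ->
  pr k (fun v => nat_of_bool (C v)) -> pr k (fun v => nat_of_bool (B v && C v)).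
Proof.
by move=> HB HC; apply: pr_ext (pr_mul HB HC) => v; case: (B v); case: (C v).
Qed.

Lemma pr_neg k B : pr k (fun v => nat_of_bool (B v)) ->
  pr k (fun v => nat_of_bool (~~ B v)).
Proof. by move=> HB; apply: pr_ext (pr_sub (pr_const _ 1) HB) => v; case: (B v). Qed.

Lemma pr_imp k B C : pr k (fun v => nat_of_bool (B v)) ->
  pr k (fun v => nat_of_bool (C v)) -> pr k (fun v => nat_of_bool (B v ==> C v)).
Proof.
move=> HB HC; apply: pr_ext (pr_neg (pr_and HB (pr_neg HC))) => v.
by case: (B v); case: (C v).
Qed.

Lemma pr_all k N P : pr k N ->
  pr k.+2 (fun v => nat_of_bool (P (v 0) (fun i => v i.+2))) ->
  pr k (fun v => nat_of_bool (all (fun i => P i v) (iota 0 (N v)))).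
Proof.
move=> HN HP.
have H := pr_rec (G := fun n r v => r * P n v) HN (pr_const _ 1) (pr_mul (pr_var _ 1) HP).
apply: pr_ext H => v; elim: (N v) => // n IH.
by rewrite -[in RHS]addn1 iotaD all_cat /= IH andbT; case: all; case: (P n v).
Qed.

Lemma pr_find k N P : pr k N ->
  pr k.+2 (fun v => nat_of_bool (P (v 0) (fun i => v i.+2))) ->
  pr k (fun v => find (fun i => P i v) (iota 0 (N v))).
Proof.
move=> HN HP.
have H := pr_rec (G := fun n r v => if r.+1 <= n then r else if P n v then n else n.+1)
  HN (pr_const _ 0)
  (pr_if (pr_leq (pr_S (pr_var _ 1)) (pr_var _ 0)) (pr_var _ 1)
     (pr_if HP (pr_var _ 0) (pr_S (pr_var _ 0)))).
apply: pr_ext H => v; elim: (N v) => // n IH.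
rewrite -[in RHS]addn1 iotaD find_cat /= IH has_find size_iota.
by case: ltnP => // _; case: (P n v); rewrite ?addn0 ?addn1.
Qed.

Lemma pr_iter k (f : nat -> nat) N F : pr 1 (fun v => f (v 0)) -> pr k N -> pr k F ->
  pr k (fun v => iter (N v) f (F v)).
Proof.
move=> Hf HN HF.
apply: pr_ext (pr_rec (G := fun _ r _ => f r) HN HF (pr_app1 Hf (pr_var _ 1))) => v.
by elim: (N v) => //= n ->.
Qed.

(** * Pairing of natural numbers *)

Fact pairing_key : unit. Proof. by []. Qed.
(** The first component is written in unary, so prefixing a fixed index to a program adds only a
    constant to its length. The lock prevents unfolding. *)
Definition pair := locked_with pairing_key (fun a z => (2 ^ a * z.*2.+1).-1).
Definition pfst := locked_with pairing_key (fun d =>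
  find (fun a => ~~ all (fun z => d.+1 != 2 ^ a * z.*2.+1) (iota 0 d.+1)) (iota 0 d.+1)).
Definition psnd := locked_with pairing_key (fun d =>
  find (fun z => d.+1 == 2 ^ pfst d * z.*2.+1) (iota 0 d.+1)).

Lemma pairS a z : (pair a z).+1 = 2 ^ a * z.*2.+1.
Proof. by rewrite [pair]unlock prednK // muln_gt0 expn_gt0. Qed.

Lemma pair_ge a z : a <= pair a z /\ z <= pair a z.
Proof.
have := pairS a z; have := @ltn_expl 2 a isT; have: 0 < 2 ^ a by rewrite expn_gt0.
by move: (2 ^ a) (pair a z) => A p; split; nia.
Qed.

Lemma pair_inj a z b w : 2 ^ a * z.*2.+1 = 2 ^ b * w.*2.+1 -> a = b /\ z = w.
Proof.
have H c u : logn 2 (2 ^ c * u.*2.+1) = c.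
  rewrite lognM ?expn_gt0 // pfactorK // [logn 2 u.*2.+1]logn_coprime ?addn0 //.
  by rewrite coprime2n /= odd_double.
move=> E; have ab : a = b by rewrite -(H a z) E H.
split=> //; move: E; rewrite ab => /eqP; rewrite eqn_mul2l expn_eq0 /= eqSS.
by move/eqP=> E; apply: double_inj.
Qed.

Lemma find_iota (P : pred nat) n i :
  i < n -> P i -> (forall j, P j -> j = i) -> find P (iota 0 n) = i.
Proof.
move=> ltin Pi uP.
have Hh : has P (iota 0 n) by apply/hasP; exists i; rewrite ?mem_iota.
have := nth_find 0 Hh; rewrite nth_iota; first exact: uP.
by rewrite -{2}(size_iota 0 n) -has_find.
Qed.

Lemma pfst_pair a z : pfst (pair a z) = a.
Proof.
have [Ha Hz] := pair_ge a z; rewrite [pfst]unlock; apply: find_iota => //.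
  apply/allPn; exists z; rewrite ?mem_iota // pairS negbK //.
by move=> b /allPn [w _]; rewrite pairS negbK => /eqP /pair_inj [].
Qed.

Lemma psnd_pair a z : psnd (pair a z) = z.
Proof.
have [Ha Hz] := pair_ge a z; rewrite [psnd]unlock; apply: find_iota => //; rewrite pfst_pair pairS //.
by move=> b /eqP /pair_inj [].
Qed.

Lemma pr_double k F : pr k F -> pr k (fun v => (F v).*2).
Proof. by move=> H; apply: pr_ext (pr_add H H) => v; rewrite addnn. Qed.

Lemma pr_pair k F G : pr k F -> pr k G -> pr k (fun v => pair (F v) (G v)).
Proof. by move=> HF HG; rewrite [pair]unlock; apply/pr_pred/pr_mul/pr_S/pr_double/HG/pr_exp2. Qed.

Lemma pr_pfst k F : pr k F -> pr k (fun v => pfst (F v)).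
Proof.
apply: pr_app1; rewrite [pfst]unlock; apply: (pr_find (P := fun a v =>
  ~~ all (fun z => (v 0).+1 != 2 ^ a * z.*2.+1) (iota 0 (v 0).+1))).
  exact/pr_S/pr_var.
apply/pr_neg/(pr_all (P := fun z v => (v 2).+1 != 2 ^ (v 0) * z.*2.+1)).
  exact/pr_S/pr_var.
apply/pr_neg/pr_eq; first exact/pr_S/pr_var.
by apply/pr_mul/pr_S/pr_double/pr_var/pr_exp2/pr_var.
Qed.

Lemma pr_psnd k F : pr k F -> pr k (fun v => psnd (F v)).
Proof.
apply: pr_app1; rewrite [psnd]unlock; apply: (pr_find (P := fun z v =>
  (v 0).+1 == 2 ^ pfst (v 0) * z.*2.+1)); first exact/pr_S/pr_var.
apply/pr_eq; first exact/pr_S/pr_var.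
by apply/pr_mul/pr_S/pr_double/pr_var/pr_exp2/pr_pfst/pr_var.
Qed.

Ltac pr_auto := repeat lazymatch goal with
  | |- pr _ (fun v => v _) => apply pr_var
  | |- pr _ (fun v => if _ then _ else _) => apply pr_if
  | |- pr _ (fun v => nat_of_bool (_ == _)) => apply pr_eq
  | |- pr _ (fun v => nat_of_bool (_ <= _)) => apply pr_leq
  | |- pr _ (fun v => nat_of_bool (_ && _)) => apply pr_and
  | |- pr _ (fun v => nat_of_bool (_ ==> _)) => apply pr_imp
  | |- pr _ (fun v => nat_of_bool (~~ _)) => apply pr_neg
  | |- pr _ (fun v => pair _ _) => apply pr_pair
  | |- pr _ (fun v => pfst _) => apply pr_pfst
  | |- pr _ (fun v => psnd _) => apply pr_psnd
  | |- pr _ (fun v => _ + _) => apply pr_add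
  | |- pr _ (fun v => _ - _) => apply pr_sub
  | |- pr _ (fun v => _ * _) => apply pr_mul
  | |- pr _ (fun v => 2 ^ _) => apply pr_exp2
  | |- pr _ (fun v => _.+1) => apply pr_S
  | |- pr _ (fun v => _.-1) => apply pr_pred
  | |- pr _ (fun v => _) => apply pr_const
  end.

(** * A step-bounded universal machine *)

(* States of an abstract machine for [prf]: evaluate a term, return a value (a number or a coded
   argument list), or evaluate a list of terms, on top of a stack [K] of frames. Frame tags:
   0 empty stack, 1 terms still to evaluate, 2 value to be consed, 3 outer function of [Comp],
   4 step of [PrimRec], 5 search of [Mu]. *)
Definition ev_st f xs K := pair 0 (pair f (pair xs K)).
Definition ret_st y K := pair 1 (pair y K).
Definition evs_st gs xs K := pair 2 (pair gs (pair xs K)).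
Definition frame t d K := pair t (pair d K).

Definition step_ev f xs K :=
  let t := pfst f in let d := psnd f in
  if t == 0 then ret_st 0 K else
  if t == 1 then ret_st (pfst xs).+1 K else
  if t == 2 then ret_st (pfst (iter d psnd xs)) K else
  if t == 3 then evs_st (psnd d) xs (frame 3 (pfst d) K) else
  if t == 4 then
    if pfst xs == 0 then ev_st (pfst d) (psnd xs) K else
    ev_st f (pair (pfst xs).-1 (psnd xs))
      (frame 4 (pair (psnd d) (pair (pfst xs).-1 (psnd xs))) K) else
  ev_st d (pair 0 xs) (frame 5 (pair d (pair 0 xs)) K).

Definition step_ret y K :=
  let t := pfst K in let d := pfst (psnd K) in let K' := psnd (psnd K) in
  if t == 0 then ret_st y K else
  if t == 1 then evs_st (pfst d) (psnd d) (frame 2 y K') else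
  if t == 2 then ret_st (pair d y) K' else
  if t == 3 then ev_st d y K' else
  if t == 4 then ev_st (pfst d) (pair (pfst (psnd d)) (pair y (psnd (psnd d)))) K' else
  if y == 0 then ret_st (pfst (psnd d)) K' else
  let xs := pair (pfst (psnd d)).+1 (psnd (psnd d)) in
  ev_st (pfst d) xs (frame 5 (pair (pfst d) xs) K').

Definition step_evs gs xs K :=
  if gs == 0 then ret_st 0 K else
  ev_st (pfst gs.-1) xs (frame 1 (pair (psnd gs.-1) xs) K).

Definition halted s := (pfst s == 1) && (pfst (psnd (psnd s)) == 0).

Definition step s :=
  if halted s then s else
  if pfst s == 0 then step_ev (pfst (psnd s)) (pfst (psnd (psnd s))) (psnd (psnd (psnd s)))
  else if pfst s == 1 then step_ret (pfst (psnd s)) (psnd (psnd s))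
  else step_evs (pfst (psnd s)) (pfst (psnd (psnd s))) (psnd (psnd (psnd s))).

Fixpoint code (p : prf) : nat :=
  match p with
  | Zero => pair 0 0
  | Succ => pair 1 0
  | Proj i => pair 2 i
  | Comp f gs => pair 3 (pair (code f) (foldr (fun g l => (pair (code g) l).+1) 0 gs))
  | PrimRec f g => pair 4 (pair (code f) (code g))
  | Mu f => pair 5 (code f)
  end.

Definition codes := foldr (fun g l => (pair (code g) l).+1) 0.
(** No end marker: since [pair 0 0 = 0], the code [0] decodes as an endless list of zeros, which
    matches the default for missing arguments. *)
Definition args := foldr pair 0.

Lemma pair00 : pair 0 0 = 0.
Proof. by apply: succn_inj; rewrite pairS. Qed.

Lemma pfst0 : pfst 0 = 0. Proof. by rewrite -{1}pair00 pfst_pair. Qed.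
Lemma psnd0 : psnd 0 = 0. Proof. by rewrite -{1}pair00 psnd_pair. Qed.

Definition pairE := (pfst_pair, psnd_pair).

Lemma pfst_args xs : pfst (args xs) = head 0 xs.
Proof. by case: xs => [|x xs]; rewrite /= ?pfst0 ?pfst_pair. Qed.

Lemma pfst_iter_args i xs : pfst (iter i psnd (args xs)) = nth 0 xs i.
Proof.
have nil j : pfst (iter j psnd 0) = 0.
  by elim: j => [|j IH]; rewrite ?iterSr ?psnd0 // pfst0.
elim: i xs => [|i IH] [|x xs]; rewrite ?nil ?nth_nil ?iterSr //; first exact: pfst_pair.
by rewrite -[args _]/(pair x (args xs)) psnd_pair IH.
Qed.

Definition reach s s' := exists n, iter n step s = s'.

Lemma reach_refl s : reach s s. Proof. by exists 0. Qed.

Lemma reach_trans s1 s2 s3 : reach s1 s2 -> reach s2 s3 -> reach s1 s3.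
Proof. by move=> [n <-] [m <-]; exists (m + n); rewrite iterD. Qed.

Lemma reach_step s1 s2 s3 : step s1 = s2 -> reach s2 s3 -> reach s1 s3.
Proof. by move=> E; apply: reach_trans; exists 1. Qed.

Lemma step_evE f xs K : step (ev_st f xs K) = step_ev f xs K.
Proof. by rewrite /step /halted !pairE. Qed.

Lemma step_retE y K : step (ret_st y K) = step_ret y K.
Proof. by rewrite /step /halted !pairE /= /step_ret; case: eqP. Qed.

Lemma step_evsE gs xs K : step (evs_st gs xs K) = step_evs gs xs K.
Proof. by rewrite /step /halted !pairE. Qed.

(* The generated induction schemes give no hypothesis under the [exists] of [ev_mu]. *)
Lemma eval_sound f xs y (H : eval f xs y) :
  forall K, reach (ev_st (code f) (args xs) K) (ret_st y K)
with evals_sound gs xs ys (H : evals gs xs ys) :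
  forall K, reach (evs_st (codes gs) (args xs) K) (ret_st (args ys) K).
Proof.
- case: H => {f xs y}.
  + move=> xs K; refine (reach_step _ (reach_refl _)).
    by rewrite step_evE /step_ev !pairE.
  + move=> xs K; refine (reach_step _ (reach_refl _)).
    by rewrite step_evE /step_ev !pairE pfst_args.
  + move=> i xs K; refine (reach_step _ (reach_refl _)).
    by rewrite step_evE /step_ev !pairE pfst_iter_args.
  + move=> f gs xs ys y /evals_sound Hgs /eval_sound Hf K.
    apply: reach_step; first by rewrite step_evE /step_ev !pairE /=; reflexivity.
    refine (reach_trans (Hgs _) _).
    refine (reach_step _ (Hf _)).
    by rewrite step_retE /step_ret /frame !pairE.
  + move=> f g xs y /eval_sound Hf K; refine (reach_step _ (Hf _)).
    by rewrite step_evE /step_ev /= !pairE.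
  + move=> f g n xs r y /eval_sound Hr /eval_sound Hg K.
    apply: reach_step; first by rewrite step_evE /step_ev /= !pairE /=; reflexivity.
    refine (reach_trans (Hr _) _).
    refine (reach_step _ (Hg _)).
    by rewrite step_retE /step_ret /frame !pairE.
  + move=> f xs n Hn Hlt K.
    have {}Hn := eval_sound _ _ _ Hn.
    have {}Hlt m : m < n -> exists v, forall K,
        reach (ev_st (code f) (args (m :: xs)) K) (ret_st v.+1 K).
      by move=> /Hlt [v Hv]; exists v; apply: eval_sound Hv.
    apply: reach_step; first by rewrite step_evE /step_ev /= !pairE /=; reflexivity.
    have: forall k m, m + k = n -> reach
      (ev_st (code f) (pair m (args xs)) (frame 5 (pair (code f) (pair m (args xs))) K))
      (ret_st n K).
      elim=> [|k IH] m.
        rewrite addn0 => ->; refine (reach_trans (Hn _) _).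
        refine (reach_step _ (reach_refl _)).
        by rewrite step_retE /step_ret /frame !pairE.
      move=> E; have [|v Hv] := Hlt m; first lia.
      refine (reach_trans (Hv _) _).
      apply: reach_step (IH m.+1 _); last lia.
      by rewrite step_retE /step_ret /frame !pairE.
    by move/(_ n 0); apply.
- case: H => {gs xs ys}.
  + move=> xs K; refine (reach_step _ (reach_refl _)).
    by rewrite step_evsE /step_evs ?pairE.
  + move=> g gs xs y ys /eval_sound Hg /evals_sound Hgs K.
    apply: reach_step; first by rewrite step_evsE /step_evs /= ?pairE /=; reflexivity.
    refine (reach_trans (Hg _) _).
    apply: reach_step; first by rewrite step_retE /step_ret /frame !pairE /=; reflexivity.
    refine (reach_trans (Hgs _) _).
    refine (reach_step _ (reach_refl _)).
    by rewrite step_retE /step_ret /frame !pairE.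
Qed.

Definition result s := if halted s then (pfst (psnd s)).+1 else 0.

(* [0] stands for "no value yet", [v.+1] for the value [v]; the clock [t] also bounds the value. *)
Definition run t e x :=
  let r := result (iter t step (ev_st e (pair x 0) 0)) in if r <= t then r else 0.

Lemma iter_step_halted n s : halted s -> iter n step s = s.
Proof. by move=> Hs; elim: n => //= n ->; rewrite /step Hs. Qed.

Lemma result_mono m n s : m <= n -> result (iter m step s) != 0 ->
  result (iter n step s) = result (iter m step s).
Proof.
move=> le_mn; rewrite {1}/result; case: ifP => // Hh _.
by rewrite -(subnK le_mn) iterD iter_step_halted.
Qed.

Lemma run_mono t t' e x : t <= t' -> run t e x != 0 -> run t' e x = run t e x.
Proof.
move=> le_tt; rewrite /run; case: ifP => // le_t Hr.
by rewrite (result_mono le_tt Hr) (leq_trans le_t le_tt).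
Qed.

Lemma run_lt t e x v : run t e x = v.+1 -> v < t.
Proof. by rewrite /run; case: ifP => // le_t E; rewrite -E. Qed.

Lemma result_ret y : result (ret_st y 0) = y.+1.
Proof. by rewrite /result /halted /ret_st !pairE pfst0. Qed.

Lemma run_complete p x y : eval p [:: x] y -> exists t, run t (code p) x = y.+1.
Proof.
(* The clock has to reach both the halting step and the value. *)
move/eval_sound/(_ 0) => /= [n Hn]; exists (maxn n y.+1).
have E : result (iter n step (ev_st (code p) (pair x 0) 0)) = y.+1.
  by rewrite Hn result_ret.
have E2 := @result_mono n (maxn n y.+1) _ (leq_maxl _ _).
by rewrite /run E2 E // leq_maxr.
Qed.

(** Both derivations drive the same machine from the same state, and the longer run cannot leave the
    halted state of the shorter one. *)
Lemma eval_det p xs y z : eval p xs y -> eval p xs z -> y = z.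
Proof.
move=> /eval_sound/(_ 0) [n Hn] /eval_sound/(_ 0) [m Hm].
wlog le_nm : n m y z Hn Hm / n <= m.
  by move=> W; case/orP: (leq_total n m) => /W H; [|symmetry]; apply: H; eauto.
have := result_mono (s := ev_st (code p) (args xs) 0) le_nm.
by rewrite Hn Hm !result_ret => /(_ isT) [].
Qed.

Lemma pr_step k F : pr k F -> pr k (fun v => step (F v)).
Proof.
apply: pr_app1; rewrite /step /halted /step_ev /step_ret /step_evs /frame /ev_st /evs_st /ret_st.
pr_auto; apply: pr_iter; pr_auto.
Qed.

Lemma pr_run k T E X : pr k T -> pr k E -> pr k X -> pr k (fun v => run (T v) (E v) (X v)).
Proof.
apply: pr_app3.
have H : pr 3 (fun v => result (iter (v 0) step (ev_st (v 1) (pair (v 2) 0) 0))).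
  apply: (pr_app1 (f := result)); first by rewrite /result /halted; pr_auto.
  apply: pr_iter; rewrite /ev_st; [exact/pr_step/pr_var | pr_auto..].
by apply: pr_if (pr_leq H (pr_var _ 0)) H (pr_const _ 0).
Qed.

(** * Clocks and descriptions *)

Lemma pr_mu k (P : nat -> (nat -> nat) -> bool) :
  pr k.+1 (fun v => nat_of_bool (P (v 0) (fun i => v i.+1))) ->
  exists q, forall xs, size xs = k ->
    (forall t, P t (nth 0 xs) -> exists t', eval q xs t') /\
    (forall t, eval q xs t -> P t (nth 0 xs)).
Proof.
(* [Mu] searches for the value [0], hence the negated test. *)
move/pr_neg => [p Hp]; exists (Mu p) => xs sz.
have {}Hp t : eval p (t :: xs) (~~ P t (nth 0 xs)) by apply: (Hp (_ :: _)); rewrite /= sz.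
split=> [t Pt | t Et].
  have ex : exists t, P t (nth 0 xs) by exists t.
  case: (ex_minnP ex) => m Pm min; exists m; apply: ev_mu.
    by have := Hp m; rewrite Pm.
  move=> j ltjm; exists 0; have := Hp j; case: (boolP (P j _)) => // /min.
  by rewrite leqNgt ltjm.
inversion Et as [| | | | | |f' xs' n Hn Hlt]; subst.
by have := eval_det (Hp t) Hn; case: (P _ _).
Qed.

(** Which of the finitely many indices ever hold is settled classically, not computed. *)
Lemma common_bound (H : nat -> nat -> bool)
    (Hmono : forall i t t', t <= t' -> H i t -> H i t') N :
  exists B, forall j t, j < N -> H j t -> H j B.
Proof.
elim: N => [|N [B HB]]; first by exists 0.
case: (classic (exists t, H N t)) => [[t Ht] | no].
  exists (maxn B t) => j t'; rewrite ltnS leq_eqVlt => /orP [/eqP -> _ | ltj Hj].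
    exact: Hmono (leq_maxr _ _) Ht.
  exact: Hmono (leq_maxl _ _) (HB _ _ ltj Hj).
exists B => j t'; rewrite ltnS leq_eqVlt => /orP [/eqP -> Ht | ]; last exact: HB.
by case: no; exists t'.
Qed.

(** A stage at which the slowest index holds has already revealed every [j < N] that ever holds, so
    one index carries the halting information of all of them. *)
Lemma slowest (H : nat -> nat -> bool)
    (Hmono : forall i t t', t <= t' -> H i t -> H i t') N :
  (exists2 i, i < N & exists t, H i t) ->
  exists i, [/\ i < N, exists t, H i t &
    forall j t t0, j < N -> H i t0 -> H j t -> H j t0].
Proof.
elim: N => [|N IH]; first by case.
case: (classic (exists2 i, i < N & exists t, H i t)) =>
  [/IH {IH} [i [ltiN Hi slow]] _ | no [i ltiN Hi]].
  case: (classic (exists t0 t, [/\ H i t0, H N t & ~ H N t0])) =>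
    [[t0 [t [Hit0 HNt nHNt0]]] | no].
    exists N; split=> //; first by exists t.
    move=> j t1 t2; rewrite ltnS leq_eqVlt => /orP [/eqP -> // | ltjN] HN2 Hj.
    apply: (Hmono _ t0) (slow _ _ _ ltjN Hit0 Hj).
    by case: (leqP t0 t2) => // /ltnW /Hmono /(_ HN2).
  exists i; split=> //; first exact: ltnW.
  move=> j t t0; rewrite ltnS leq_eqVlt => /orP [/eqP -> | ltjN] Hi0 Hj; last exact: slow Hj.
  by apply/negP => /negP n0; apply: no; exists t0, t; split=> //; apply/negP.
have eN j : j < N.+1 -> (exists t, H j t) -> j = N.
  by rewrite ltnS leq_eqVlt => /orP [/eqP // | ltj Hj]; case: no; exists j.
exists i; split=> // j t t0 ltj Hi0 Hj; rewrite (eN j ltj) -?(eN i ltiN) //.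
by exists t.
Qed.

(** The guard makes a halting stage bound the program too, so a statement about all programs halting
    within [u] is a bounded quantification. *)
Definition W t y := if y <= t then run t (pfst y) (psnd y) else 0.
Definition conv t e z := all (fun i => run t e i != 0) (iota 0 z.+1).
(** The graph of a partial function. Checking a guessed [t] is primitive recursive even for partial
    [e], so clocks can be enumerated. *)
Definition tau e z t := conv t e z && ~~ conv t.-1 e z.

Lemma W_ge t y : W t y != 0 -> y <= t. Proof. by rewrite /W; case: (leqP y t). Qed.

Lemma W_lt t y x : W t y = x.+1 -> x < t.
Proof. by rewrite /W; case: (leqP y t) => // _ /run_lt. Qed.

Lemma W_mono t t' y : t <= t' -> W t y != 0 -> W t' y = W t y.
Proof.
move=> le_tt; rewrite /W; case: (leqP y t) => // le_yt Hr.
by rewrite (leq_trans le_yt le_tt); apply: run_mono.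
Qed.

Lemma W_halt_mono y t t' : t <= t' -> W t y != 0 -> W t' y != 0.
Proof. by move=> le_tt Ht; rewrite (W_mono le_tt Ht). Qed.

Lemma W_det t t' y : W t y != 0 -> W t' y != 0 -> W t y = W t' y.
Proof.
move=> Ht Ht'; case/orP: (leq_total t t') => le_tt.
  by rewrite (W_mono le_tt Ht).
by rewrite (W_mono le_tt Ht').
Qed.

Lemma W_complete p x y : eval p [:: x] y -> exists t, W t (pair (code p) x) = y.+1.
Proof.
case/run_complete => t Ht; exists (maxn t (pair (code p) x)).
by rewrite /W leq_maxr !pairE (run_mono (leq_maxl _ _)) Ht.
Qed.

Lemma convP t e z : reflect (forall i, i <= z -> run t e i != 0) (conv t e z).
Proof.
apply: (iffP allP) => Hr i; first by move=> lei; apply: Hr; rewrite mem_iota.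
by rewrite mem_iota => /= lei; apply: Hr.
Qed.

Lemma conv_mono e z t t' : t <= t' -> conv t e z -> conv t' e z.
Proof.
move=> le_tt /convP Hc; apply/convP => i lei.
by rewrite (run_mono le_tt) ?Hc.
Qed.

Lemma conv_le t e z z' : z' <= z -> conv t e z -> conv t e z'.
Proof. by move=> le_zz /convP Hc; apply/convP => i lei; apply/Hc/(leq_trans lei). Qed.

Lemma tau_least e z t t' : tau e z t -> conv t' e z -> t <= t'.
Proof.
case/andP=> _ Hn Hc; rewrite leqNgt; apply/negP => ltt.
by move/negP: Hn; apply; apply: conv_mono Hc; lia.
Qed.

Lemma tau_exists e z t : conv t e z -> exists t', tau e z t'.
Proof.
move=> Hc; have ex : exists t, conv t e z by exists t.
case: (ex_minnP ex) => m Hm min; exists m; rewrite /tau Hm /=; apply/negP => Hp.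
(* The minimum is positive because clock [0] admits no value; [m.-1] is then a smaller stage. *)
have := min _ Hp; case: m Hm {min Hp} => [|m _]; last by rewrite ltnn.
by move/convP/(_ 0 isT); case E: run => [|v] // _; have := run_lt E.
Qed.

Lemma conv_total e : (forall i, exists t, run t e i != 0) -> forall z, exists t, conv t e z.
Proof.
move=> tot z; have mono i t t' : t <= t' -> run t e i != 0 -> run t' e i != 0.
  by move=> le_tt Hr; rewrite (run_mono le_tt Hr).
have [B HB] := common_bound mono z.+1; exists B; apply/convP => i lei.
by have [t Ht] := tot i; apply: HB Ht.
Qed.

Lemma pr_W k T Y : pr k T -> pr k Y -> pr k (fun v => W (T v) (Y v)).
Proof.
apply: pr_app2; apply: pr_if; [exact: pr_leq (pr_var _ 1) (pr_var _ 0) | | exact: pr_const].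
apply: pr_run; pr_auto.
Qed.

Lemma pr_conv k T E Z : pr k T -> pr k E -> pr k Z ->
  pr k (fun v => nat_of_bool (conv (T v) (E v) (Z v))).
Proof.
move=> HT HE HZ; apply: (pr_app3 (f := fun t e z => nat_of_bool (conv t e z)) _ HT HE HZ).
apply: (pr_all (P := fun i v => run (v 0) (v 1) i != 0)); first exact/pr_S/pr_var.
by apply/pr_neg/pr_eq/pr_const/pr_run; apply: pr_var.
Qed.

Lemma pr_tau k E Z T : pr k E -> pr k Z -> pr k T ->
  pr k (fun v => nat_of_bool (tau (E v) (Z v) (T v))).
Proof.
by move=> HE HZ HT; apply: pr_and; [|apply: pr_neg]; apply: pr_conv => //; apply: pr_pred.
Qed.

Lemma W_partial_recursive : exists q, forall t y x, W t y = x.+1 -> eval q [:: y] x.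
Proof.
have [|q Hq] := @pr_mu 1 (fun t v => W t (v 0) != 0).
  by apply/pr_neg/pr_eq/pr_const/pr_W; apply: pr_var.
have [w Hw] := pr_pred (pr_W (pr_var 2 0) (pr_var 2 1)).
exists (Comp w [:: q; Proj 0]) => t y x E.
have [Hq1 Hq2] := Hq [:: y] erefl.
have [|t' Ht'] := Hq1 t; first by rewrite /= E.
apply: (ev_comp (ys := [:: t'; y])).
  by do 3?constructor => //; apply: ev_proj.
have := Hw [:: t'; y] erefl; rewrite /= (@W_det t' t) ?E //.
exact: Hq2 Ht'.
Qed.

(** A machine searching for a stage that satisfies [Q] outputs this stage, and an output is below
    the running time; by monotonicity [Q] holds at the running time. *)
Lemma tau_dominates (Q : nat -> nat -> bool) :
  pr 2 (fun v => nat_of_bool (Q (v 0) (v 1))) ->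
  (forall t t' u, t <= t' -> Q t u -> Q t' u) -> (forall u, exists t, Q t u) ->
  exists e, forall u, exists2 t, tau e u t & Q t u.
Proof.
move=> HQ mono ex.
have [|q Hq] := @pr_mu 1 (fun t v => Q t (v 0)); first exact: HQ.
have tot u : exists t g, run t (code q) u = g.+1 /\ Q g u.
  have [Hq1 Hq2] := Hq [:: u] erefl.
  have [t Ht] := ex u; have [g Hg] := Hq1 t Ht.
  by have [t' Ht'] := run_complete Hg; exists t', g; split=> //; apply: Hq2.
exists (code q) => u.
have [|t Ht] := @conv_total (code q) _ u.
  by move=> i; have [t [g [E _]]] := tot i; exists t; rewrite E.
have [t' Ht'] := tau_exists Ht; exists t' => //.
case/andP: Ht' => /convP/(_ u (leqnn u)) Hr _.
have [s [g [Hs Qg]]] := tot u; apply: mono Qg; apply: ltnW.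
have := @run_mono s (maxn s t') (code q) u (leq_maxl _ _).
rewrite (run_mono (leq_maxr _ _) Hr) Hs => /(_ isT) E; exact: run_lt E.
Qed.

(** The weight [4] outweighs the roughly [2k] bits that [pair] spends on [k] and an index below
    [k]. *)
Inductive clock z : nat -> nat -> Prop :=
| clock0 : clock z 0 z
| clockS c u e t : clock z c u -> tau e u t -> clock z (c + e.+1 * 4) t.

(** The start [z] is not charged, only bounded by [y], so it stays admissible when [y] is prefixed
    by an index. *)
Definition desc x k := exists y z c u,
  [/\ z <= y, clock z c u, len y + c <= k & W u y = x.+1].

Lemma leq_len y L : (len y <= L) = (y.+1 < 2 ^ L.+1).
Proof.
rewrite /len; apply/idP/idP => [le_L | lt_y].
  apply: leq_trans (trunc_log_ltn _ (isT : 1 < 2)) _.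
  by rewrite leq_pexp2l.
have := @trunc_logP 2 y.+1 isT isT => H.
by have := leq_ltn_trans H lt_y; rewrite ltn_exp2l.
Qed.

(** The number [z.*2.+1] is less than twice [z.+1], and the factor [2 ^ a] appends [a] binary
    zeros. *)
Lemma len_pair a z : len (pair a z) <= a + (len z).+1.
Proof.
rewrite leq_len pairS -addnS expnD ltn_pmul2l ?expn_gt0 //.
have: z.+1 < 2 ^ (len z).+1 by rewrite -leq_len.
by rewrite [2 ^ (len z).+2]expnS; lia.
Qed.

Lemma desc_leq x k k' : k <= k' -> desc x k -> desc x k'.
Proof.
move=> le_kk [y [z [c [u [Hz Hc Hl Hw]]]]]; exists y, z, c, u; split=> //.
exact: leq_trans Hl le_kk.
Qed.

(** The identity program halts on all inputs, so one passage started at [x] gives it enough time. *)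
Lemma desc_len : exists c, forall x, desc x (len x + c).
Proof.
pose i := code (Proj 0).
have Hi x : exists t, W t (pair i x) = x.+1 by apply/W_complete/ev_proj.
have [||| e He] := @tau_dominates (fun t u => W t (pair i u) != 0).
- by apply/pr_neg/pr_eq/pr_const/pr_W; [apply: pr_var|apply: pr_pair; pr_auto].
- by move=> t t' u; apply: W_halt_mono.
- by move=> u; have [t Ht] := Hi u; exists t; rewrite Ht.
exists (i + 1 + e.+1 * 4) => x; have [t Ht HW] := He x.
exists (pair i x), x, (0 + e.+1 * 4), t; split.
- by have [] := pair_ge i x.
- exact: clockS (clock0 x) Ht.
- by have := len_pair i x; lia.
- by have [s Hs] := Hi x; rewrite (@W_det t s) ?Hs.
Qed.

(** Prefixing the code of [f] after [W] turns a program for [x] into one for [f x]; the slowdown is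
    total computable, so one more passage covers it. *)
Lemma desc_total f : total_computable f ->
  exists c, forall x k, desc x k -> desc (f x) (k + c).
Proof.
case=> p Hp; have [w Hw] := W_partial_recursive.
pose i := code (Comp p [:: w]).
have Hi t y x : W t y = x.+1 -> exists t', W t' (pair i y) = (f x).+1.
  move=> /Hw Hy; apply: W_complete.
  by apply: (ev_comp (ys := [:: x])) => //; do 2?constructor.
(* Here [u] bounds both the programs and their running time, so the test is decidable and finitely
   many runs have to be awaited. *)
pose Q t u := all (fun y => (W u y != 0) ==> (W t (pair i y) != 0)) (iota 0 u.+1).
have mono y t t' : t <= t' -> W t (pair i y) != 0 -> W t' (pair i y) != 0.
  exact: W_halt_mono.
have [||| e He] := @tau_dominates Q.
- apply: (pr_all (P := fun y v => (W (v 1) y != 0) ==> (W (v 0) (pair i y) != 0))).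
    exact/pr_S/pr_var.
  apply: pr_imp; apply/pr_neg/pr_eq/pr_const/pr_W; pr_auto.
- move=> t t' u le_tt /allP HQ; apply/allP => y /HQ /implyP Hy.
  by apply/implyP => /Hy; apply: mono.
- move=> u; have [B HB] := common_bound mono u.+1; exists B; apply/allP => y.
  rewrite mem_iota => ltyu; apply/implyP; case E: (W u y) => [|x] // _.
  by have [t' Ht'] := Hi _ _ _ E; apply: (HB _ t'); rewrite ?Ht'.
exists (i + 1 + e.+1 * 4) => x k [y [z [c [u [Hz Hc Hl HW]]]]].
have [t Ht /allP HQ] := He u.
have Hyu : y <= u by apply: W_ge; rewrite HW.
have {HQ} := HQ y; rewrite mem_iota ltnS Hyu HW => /(_ isT) /= HWt.
exists (pair i y), z, (c + e.+1 * 4), t; split.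
- by have [_ Hy] := pair_ge i y; apply: leq_trans Hy.
- exact: clockS Hc Ht.
- by have := len_pair i y; lia.
- by have [s Hs] := Hi _ _ _ HW; rewrite (@W_det t s) ?Hs.
Qed.

(* [s] codes the clock, the cost so far, and a guessed list of pairs [(e, t)]; any prefix of
   valid guesses is a clock, so the guesses need not be checked further. *)
Definition clock_step s :=
  let l := psnd (psnd s) in let e := pfst (pfst l) in let t := psnd (pfst l) in
  if tau e (pfst s) t then pair t (pair (pfst (psnd s) + e.+1 * 4) (psnd l)) else s.

Lemma clock_step_sound z l n : let s := iter n clock_step (pair z (pair 0 l)) in
  clock z (pfst (psnd s)) (pfst s).
Proof.
elim: n => [|n IH] /=; first by rewrite !pairE; apply: clock0.
rewrite {1 3}/clock_step; case: ifP => // Ht; rewrite !pairE.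
exact: clockS IH Ht.
Qed.

(** The unread rest [l'] is arbitrary, which lets the induction place the next guess there. *)
Lemma clock_step_complete z c u : clock z c u ->
  forall l', exists l n, iter n clock_step (pair z (pair 0 l)) = pair u (pair c l').
Proof.
elim=> [l' | {}c {}u e t _ IH Ht l']; first by exists l', 0.
have [l [n E]] := IH (pair (pair e t) l'); exists l, n.+1.
by rewrite /= E /clock_step !pairE Ht.
Qed.

Lemma desc_ce : exists p, forall x k, desc x k <-> exists v, eval p [:: x; k] v.
Proof.
(* [v] codes the program, the starting point, the number of steps and the list of guesses. *)
pose s v := iter (pfst (psnd (psnd v))) clock_step
                 (pair (pfst (psnd v)) (pair 0 (psnd (psnd (psnd v))))).
(* The bound [len y + c <= k] is split, as subtraction truncates, and [len] is replaced by the test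
   of [leq_len]. *)
pose P v x k := [&& pfst (psnd v) <= pfst v, pfst (psnd (s v)) <= k,
  (pfst v).+1 < 2 ^ (k - pfst (psnd (s v))).+1 & W (pfst (s v)) (pfst v) == x.+1].
have prs m F : pr m F -> pr m (fun v => s (F v)).
  apply: pr_app1; apply: pr_iter; last by pr_auto.
    rewrite /clock_step; apply: pr_if; last by pr_auto.
      by apply: pr_tau; pr_auto.
    by pr_auto.
  by pr_auto.
have [|p Hp] := @pr_mu 2 (fun v xk => P v (xk 0) (xk 1)).
  have Hs := prs 3 _ (pr_var 3 0).
  apply: pr_and; first by pr_auto.
  apply: pr_and; first by apply/pr_leq/pr_var/pr_pfst/pr_psnd.
  apply: pr_and.
    apply: pr_leq; first by pr_auto.
    by apply/pr_exp2/pr_S/pr_sub/pr_pfst/pr_psnd/Hs/pr_var.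
  by apply/pr_eq/pr_S/pr_var/pr_W; [apply: pr_pfst | pr_auto].
exists p => x k; have [Hp1 Hp2] := Hp [:: x; k] erefl.
split=> [[y [z [c [u [Hz Hc Hl HW]]]]] | [v /Hp2 /= /and4P [Hz Hc Hl /eqP HW]]].
  have [l [n E]] := clock_step_complete Hc 0.
  apply: (Hp1 (pair y (pair z (pair n l)))).
  rewrite /P /s !pairE E !pairE Hz HW eqxx andbT -leq_len /=.
  by apply/andP; split; lia.
exists (pfst v), (pfst (psnd v)), (pfst (psnd (s v))), (pfst (s v)); split=> //.
- exact: clock_step_sound.
- by move: Hl; rewrite -leq_len; lia.
Qed.

(** * The gap between A and C *)

(* If the indices below [k] that halt on [0..D] within [t1] are exactly the total ones, one level
   of the tower is computable and dominates one application of any of their [tau]. *)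
Inductive tower k t1 D h0 : nat -> nat -> Prop :=
| tower0 : tower k t1 D h0 0 h0
| towerS n h h' : tower k t1 D h0 n h -> h <= h' ->
    (forall i, i < k -> conv t1 i D -> conv h' i h) -> tower k t1 D h0 n.+1 h'.

(** Three searches in turn: a halting stage of [y], a stage by which [e] has converged on
    [[0..y+1]], and the levels of the tower. The last hypothesis makes every search for a level
    succeed. *)
Lemma tower_machine : exists T, forall k e y t,
  W t y != 0 -> (exists t1, conv t1 e y.+1) ->
  (forall i t1, i < k -> conv t1 i y.+1 -> forall z, exists t, conv t i z) ->
  exists x t0 t1, [/\ eval T [:: pair k (pair e y)] x, W t0 y != 0, conv t1 e y.+1 &
    tower k t1 y.+1 (t0 + 2 ^ (k * 4).+1 * y.+1) (k * 4) x].
Proof.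
have [|q0 Hq0] := @pr_mu 1 (fun t v => W t (psnd (psnd (v 0))) != 0).
  by apply/pr_neg/pr_eq/pr_const/pr_W; pr_auto.
have [|q1 Hq1] := @pr_mu 1 (fun t v => conv t (pfst (psnd (v 0))) (psnd (psnd (v 0))).+1).
  by apply: pr_conv; pr_auto.
have [|q Hq] := @pr_mu 4 (fun t v => (v 0 <= t) &&
    all (fun i => conv (v 2) i (v 3) ==> conv t i (v 0)) (iota 0 (v 1))).
  apply: pr_and; first by pr_auto.
  apply: (pr_all (P := fun i v => conv (v 3) i (v 4) ==> conv (v 0) i (v 1))).
    exact: pr_var.
  by apply: pr_imp; apply: pr_conv; apply: pr_var.
have [pn Hpn] : pr 1 (fun v => pfst (v 0) * 4) by pr_auto.
have [ph Hph] : pr 2 (fun v => v 0 + 2 ^ (pfst (v 1) * 4).+1 * (psnd (psnd (v 1))).+1) by pr_auto.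
have [pk Hpk] : pr 1 (fun v => pfst (v 0)) by pr_auto.
have [pD HpD] : pr 1 (fun v => (psnd (psnd (v 0))).+1) by pr_auto.
(* The recursion step sees the counter, the current level, [h0], [k], [t1], [D]; the projections
   skip the counter and [h0]. *)
pose G := PrimRec (Proj 0) (Comp q [:: Proj 1; Proj 3; Proj 4; Proj 5]).
exists (Comp G [:: pn; Comp ph [:: q0; Proj 0]; pk; q1; pD]) => k e y t HW [t1 Ht1] tot.
set w := pair k (pair e y).
have [H1 H2] := Hq0 [:: w] erefl; have [|t0 E0] := H1 t; first by rewrite /= /w !pairE.
have {H1 H2} HW0 := H2 _ E0; rewrite /= /w !pairE in HW0.
have [H1 H2] := Hq1 [:: w] erefl; have [|t2 E1] := H1 t1; first by rewrite /= /w !pairE.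
have {H1 H2} HC1 := H2 _ E1; rewrite /= /w !pairE in HC1.
(* The second summand exceeds every program of length at most [len y + k * 4], hence every
   admissible start. *)
set h0 := t0 + 2 ^ (k * 4).+1 * y.+1.
have Hn n : exists x, eval G [:: n; h0; k; t2; y.+1] x /\ tower k t2 y.+1 h0 n x.
  elim: n => [|n [h [Eh Th]]].
    by exists h0; split; [apply/ev_rec0/ev_proj | apply: tower0].
  have [H1 H2] := Hq [:: h; k; t2; y.+1] erefl.
  have mono i a b : a <= b -> conv a i h -> conv b i h by apply: conv_mono.
  have [B HB] := common_bound mono k.
  have [|h' Eh'] := H1 (maxn h B).
    rewrite /= leq_maxl /=; apply/allP => i; rewrite mem_iota => /= ltik.
    apply/implyP => Hi; have [s Hs] := tot i t2 ltik Hi h.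
    exact: conv_mono (leq_maxr _ _) (HB _ _ ltik Hs).
  have /= /andP [le_h /allP Hall] := H2 _ Eh'.
  exists h'; split; last first.
    apply: towerS Th le_h _ => i ltik Hi.
    by have := Hall i; rewrite mem_iota Hi => /(_ ltik).
  apply: ev_recS Eh _; apply: (ev_comp (ys := [:: h; k; t2; y.+1])) => //.
  by do 5?constructor; apply: ev_proj.
have [x [Ex Tx]] := Hn (k * 4); exists x, t0, t2; split=> //.
apply: (ev_comp (ys := [:: k * 4; h0; k; t2; y.+1])) => //.
constructor; first by have := Hpn [:: w] erefl; rewrite /= /w pfst_pair.
constructor.
  apply: (ev_comp (ys := [:: t0; w])).
    by do 3?constructor => //; apply: ev_proj.
  by have := Hph [:: t0; w] erefl; rewrite /= /w !pairE.
constructor; first by have := Hpk [:: w] erefl; rewrite /= /w pfst_pair.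
constructor=> //; constructor; last by constructor.
by have := HpD [:: w] erefl; rewrite /= /w !pairE.
Qed.

(** If [i] never converges on [[0..z0]], then [tau] is defined only below [z0] and takes finitely
    many values. Once [D] is at least [M], converging on [[0..D]] amounts to totality for indices
    below [k]. *)
Lemma partial_bound k : exists M, forall i D, i < k -> M <= D ->
  (forall z, exists t, conv t i z) \/
  ((forall t, ~~ conv t i D) /\ forall z t, tau i z t -> t <= M).
Proof.
elim: k => [|k [M HM]]; first by exists 0.
case: (classic (forall z, exists t, conv t k z)) => [tot | ].
  exists M => i D; rewrite ltnS leq_eqVlt => /orP [/eqP -> _|]; first by left.
  exact: HM.
case/not_all_ex_not => z0 /not_ex_all_not no.
have mono z t t' : t <= t' -> conv t k z -> conv t' k z by apply: conv_mono.
have [B HB] := common_bound mono z0.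
exists (maxn M (maxn B z0)) => i D; rewrite !geq_max ltnS leq_eqVlt.
move=> lti /and3P [leM leB lez]; case/orP: lti => [/eqP -> {i} | lti].
  right; split=> [t|z t Ht]; first by apply/negP => /(conv_le lez) /no.
  have Hc : conv t k z by case/andP: Ht.
  suff : t <= B by lia.
  apply: tau_least Ht (HB z t _ Hc); rewrite ltnNge; apply/negP => le_z0.
  by apply: (no t); apply: conv_le Hc.
have [|[H1 H2]] := HM i D lti leM; [by left | right].
by split=> // z t /H2; lia.
Qed.

(** The slowest program up to the length of some [y1] works, where [y1] halts later than every
    halting program below [M]. *)
Lemma record_description M : exists y, [/\ M <= y, exists t, W t y != 0 &
  forall y' t t0, len y' <= len y -> W t0 y != 0 -> W t y' != 0 -> W t0 y' != 0].
Proof.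
have mono y t t' : t <= t' -> W t y != 0 -> W t' y != 0 by apply: W_halt_mono.
have [B HB] := common_bound mono M.
(* An identity program on an input above [B]: the guard in [W] keeps it from halting by stage
   [B]. *)
pose y1 := pair (code (Proj 0)) (maxn B.+1 M).
have lt_B : maxn B.+1 M <= y1 by have [] := pair_ge (code (Proj 0)) (maxn B.+1 M).
have Hy1 : exists t, W t y1 != 0.
  by have [t Ht] := W_complete (ev_proj 0 [:: maxn B.+1 M]); exists t; rewrite Ht.
have lt_len y : (y < (2 ^ (len y1).+1).-1) = (len y <= len y1).
  by rewrite leq_len; have := expn_gt0 2 (len y1).+1; lia.
have [|y [lty Hy slow]] := slowest mono (N := (2 ^ (len y1).+1).-1).
  by exists y1 => //; rewrite lt_len.
exists y; split=> // [|y' t t0 le_len].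
  rewrite leqNgt; apply/negP => lt_M; have [t Ht] := Hy.
  have Hy1B : W B y1 != 0.
    have [s Hs] := Hy1; apply: (slow _ s) (HB _ _ lt_M Ht) Hs.
    by rewrite lt_len.
  by have := W_ge Hy1B; lia.
by apply: slow; rewrite lt_len; apply: leq_trans le_len _; rewrite -lt_len.
Qed.

Lemma tower_ge k t1 D h0 n h : tower k t1 D h0 n h -> h0 <= h.
Proof. by elim=> // {}n {}h h' _ IH le_h _; apply: leq_trans IH le_h. Qed.

(** Each passage costs at least [4], so there are at most [n] of them, and the bound on [c] forces
    their indices below [k]. An index convergent on [[0..D]] by [t1] climbs at most one level; any
    other lands at or below [M]. *)
Lemma clock_tower k t1 D h0 n h M z c u : tower k t1 D h0 n h ->
  M <= h0 -> z <= h0 -> clock z c u -> c <= n -> c < k.+1 * 4 ->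
  (forall i, i < k -> conv t1 i D \/ forall z t, tau i z t -> t <= M) -> u <= h.
Proof.
move=> HT leM lez Hc lecn ltck Hk; elim: HT c u Hc lecn ltck => [|{}n {}h h' HT IH le_h Hh] c u.
  by case=> // {}c {}u e t _ _; lia.
have le0 := leq_trans (tower_ge HT) le_h.
case=> [_ _|{}c {}u e t Hc Ht lec ltc]; first exact: leq_trans lez le0.
have [|H1|H1] := Hk e; first lia.
  apply: tau_least Ht _; apply: conv_le (Hh e _ H1); last lia.
  by apply: IH Hc _ _; lia.
by apply: leq_trans (H1 _ _ Ht) _; lia.
Qed.

Lemma desc_gap : exists T c0, forall k, c0 <= k -> exists w x m,
  [/\ eval T [:: w] x, len w <= m + k * 2 & forall n, desc x n -> m + k * 4 <= n].
Proof.
(* The identity is a total index; [k] must exceed it so that a slowest index exists. *)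
have [T HT] := tower_machine; exists T, (code (Proj 0)).+1 => k lek.
have [M HM] := partial_bound k.
have [y [leMy Hy slow]] := record_description M.
have mono i t t' : t <= t' -> conv t i y.+1 -> conv t' i y.+1 by apply: conv_mono.
have [|e [ltek He eslow]] := slowest mono (N := k).
  exists (code (Proj 0)) => //; apply: conv_total => i.
  by have [t Ht] := run_complete (ev_proj 0 [:: i]); exists t; rewrite Ht.
have [t HWt] := Hy.
have [|x [t0 [t1 [Ex HW0 Ht1 Tx]]]] := HT k e y t HWt He.
  move=> i s ltik Hs; have [//|[no _]] := HM i y.+1 ltik (leqW leMy).
  by have := no s; rewrite Hs.
(* The pairing adds at most [k + e + 2] to [len y], and [e < k]. *)
exists (pair k (pair e y)), x, (len y).+1; split=> //.
  by have := len_pair k (pair e y); have := len_pair e y; lia.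
move=> n [y' [z [c [u [lez Hc lel HWu]]]]].
rewrite leqNgt; apply/negP => ltn.
have lex := tower_ge Tx.
have ltux : x < u := W_lt HWu.
(* A clock of cost at least [k * 4] leaves [y'] no longer than [y], so [y'] halts by [t0] and its
   value is below [t0 <= x]. A cheaper clock is bounded by the tower: [u <= x], against [x < u]. *)
case: (leqP (k * 4) c) => ltc.
  have : W t0 y' != 0 by apply: (slow y' u) => //; [lia | rewrite HWu].
  move=> H0; have E : W t0 y' = x.+1 by rewrite (@W_det t0 u) ?HWu.
  by have := W_lt E; lia.
have le_y' : y' < 2 ^ (k * 4).+1 * y.+1.
  have : len y' <= k * 4 + len y by lia.
  rewrite leq_len => H1.
  have H2 : 2 ^ (k * 4 + len y).+1 <= 2 ^ (k * 4).+1 * y.+1.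
    by rewrite -addSn expnD leq_pmul2l ?expn_gt0 //; apply: trunc_logP.
  lia.
suff : u <= x by lia.
apply: (clock_tower (M := y.+1) Tx _ _ Hc); try lia.
  have := leq_pmull y.+1 (expn_gt0 2 (k * 4).+1); lia.
(* By the choice of [e], an index not convergent on [[0..y+1]] by [t1] never will be, hence is
   partial. *)
move=> i ltik; case: (boolP (conv t1 i y.+1)) => Hi; [by left | right => z' s Hs].
have [tot|[_ HMi]] := HM i y.+1 ltik (leqW leMy).
  by have [r Hr] := tot y.+1; case/negP: Hi; apply: eslow Hr.
by have := HMi _ _ Hs; lia.
Qed.

(** * Counting described strings and assembling the function [A] *)

Lemma ex_least (P : nat -> Prop) : (exists n, P n) ->
  exists n, P n /\ forall m, P m -> n <= m.
Proof.
case=> n; elim/ltn_ind: n => n IH Pn.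
case: (classic (exists2 m, m < n & P m)) => [[m ltmn Pm]|no]; first exact: IH Pm.
exists n; split=> // m Pm; rewrite leqNgt; apply/negP => ltmn.
by apply: no; exists m.
Qed.

(** [W] gives each program at most one value, so choosing a program of length at most [n] for each
    [x] is injective, and all of these lie below [2 * 2 ^ n]. *)
Lemma desc_count n (p : pred nat) m : (forall x, p x -> desc x n) ->
  count p (iota 0 m) <= 2 * 2 ^ n.
Proof.
move=> Hp; rewrite -size_filter.
have Hy x : exists y, p x -> y < 2 * 2 ^ n /\ exists u, W u y = x.+1.
  case: (boolP (p x)) => [/Hp [y [z [c [u [_ _ lel HW]]]]] | _]; last by exists 0.
  exists y => _; split; last by exists u.
  have : len y <= n by lia.
  by rewrite leq_len expnS; lia.
pose f x := proj1_sig (constructive_indefinite_description _ (Hy x)).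
have Hf x : p x -> f x < 2 * 2 ^ n /\ exists u, W u (f x) = x.+1.
  exact: (proj2_sig (constructive_indefinite_description _ (Hy x))).
rewrite -(size_map f) -[leqRHS](size_iota 0); apply: uniq_leq_size.
  rewrite map_inj_in_uniq ?filter_uniq ?iota_uniq // => x x'.
  rewrite !mem_filter => /andP [/Hf [_ [u Hu]] _] /andP [/Hf [_ [u' Hu']] _] E.
  by have := @W_det u u' (f x'); rewrite Hu' -E Hu => /(_ isT isT) [].
move=> y /mapP [x Hx ->]; move: Hx; rewrite mem_filter => /andP [/Hf [lt _] _].
by rewrite mem_iota.
Qed.

Theorem theorem2 (U : prf) (HU : optimal U) :
  exists A : nat -> nat,
    [/\ upper_semicomputable A,
        (exists c : nat, forall x : nat, A x <= len x + c),
        (exists d : nat, forall n m : nat,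
            count (fun x => A x <= n) (iota 0 m) <= d * 2 ^ n),
        (forall f : nat -> nat, total_computable f ->
            exists cf : nat, forall x : nat, A (f x) <= A x + cf) &
        (forall b : nat, exists x Cx : nat,
            KC U x Cx /\ (b < A x - Cx \/ b < Cx - A x))].
Proof.
have [c Hc] := desc_len.
have ex x : exists a, desc x a /\ forall k, desc x k -> a <= k.
  by apply: ex_least; exists (len x + c).
pose A x := proj1_sig (constructive_indefinite_description _ (ex x)).
have [A1 A2] : (forall x, desc x (A x)) /\ forall x k, desc x k -> A x <= k.
  by split=> x; have [] := proj2_sig (constructive_indefinite_description _ (ex x)).
have AE x k : A x <= k <-> desc x k.
  by split=> [le_k|]; [apply: desc_leq (A1 x) | apply: A2].
exists A; split.
- by have [p Hp] := desc_ce; exists p => x k; rewrite AE.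
- by exists c => x; apply/AE.
- by exists 2 => n m; apply: desc_count => x /AE.
- move=> f /desc_total [cf Hf]; exists cf => x; exact/A2/Hf.
move=> b; have [T [c0 HT]] := desc_gap; have [cT HcT] := HU T.
(* For this [k] the difference is at least [k * 2 - cT], which exceeds [b]. *)
have [|w [x [m [Ew lew gap]]]] := HT (c0 + cT + b.+1); first lia.
have [y [Ey ley]] := HcT _ _ Ew.
have [|Cx [[y0 [Ey0 E0]] Cmin]] := @ex_least (fun n => exists y, eval U [:: y] x /\ len y = n).
  by exists (len y), y.
have HC y' : eval U [:: y'] x -> Cx <= len y' by move=> Ey'; apply: Cmin; exists y'.
exists x, Cx; split; first by split=> //; exists y0.
by left; have := gap _ (A1 x); have := HC y Ey; lia.
Qed.
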